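(* For every $n\in\mathbb{Z}_{\geq 0}$, \[ \sum_{l=0}^{n}(-1)^{l}C_{n-l}^{(-l-1)} = -G_{n+2}. \]
   Context: For $k\in\mathbb{Z}$ let $\mathrm{Li}_k(z)=\sum_{m\ge1} z^m/m^k$ (a rational function of $z$ for $k\le0$). The poly-Bernoulli numbers $C_n^{(k)}$ are defined by $\frac{\mathrm{Li}_k(1-e^{-t})}{e^t-1}=\sum_{n\ge0}C_n^{(k)}\frac{t^n}{n!}$. The Genocchi numbers $G_n$ are defined by $\frac{2t}{e^t+1}=\sum_{n\ge0}G_n\frac{t^n}{n!}$. *)

(* Defs.v *)
From mathcomp Require Import all_boot all_order all_algebra.

Set Implicit Arguments.
Unset Strict Implicit.
Unset Printing Implicit Defensive.

Import Order.TTheory GRing.Theory Num.Theory.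
Local Open Scope ring_scope.

(* The formal power series \sum_n f n * t^n is encoded by its coefficient
   sequence f : nat -> rat. *)
Notation fps := (nat -> rat).

Definition fps_one : fps := fun n => (n == 0%N)%:R.

Definition fps_mul (f g : fps) : fps :=
  fun n => \sum_(i < n.+1) f i * g (n - i)%N.

Definition fps_exp (f : fps) (m : nat) : fps := iter m (fps_mul f) fps_one.

(* f(g(t)), for g 0 = 0: then g ^ m only has terms of degree >= m, so that
   truncating the sum at m = n is exact. *)
Definition fps_comp (f g : fps) : fps :=
  fun n => \sum_(m < n.+1) f m * fps_exp g m n.

(* The coefficients of degree < n of f / g, for g 0 != 0. *)
Fixpoint fps_div_seq (f g : fps) (n : nat) : seq rat :=
  if n is m.+1 then
    let s := fps_div_seq f g m in
    rcons s ((f m - \sum_(i < m) g (m - i)%N * s`_i) / g 0%N)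
  else [::].

Definition fps_div (f g : fps) : fps := fun n => (fps_div_seq f g n.+1)`_n.

(* f / t, for f 0 = 0. *)
Definition fps_divX (f : fps) : fps := fun n => f n.+1.

Definition egf (a : nat -> rat) : fps := fun n => a n / n`!%:R.

(* e^(c t) *)
Definition fps_expt (c : rat) : fps := egf (fun n => c ^+ n).

Definition Li (k : int) : fps :=
  fun m => if m == 0%N then 0 else m%:R ^ (- k).

Definition Li_one_sub_exp (k : int) : fps :=
  fps_comp (Li k) (fun n => fps_one n - fps_expt (-1) n).

Definition exp_sub_one : fps := fun n => fps_expt 1 n - fps_one n.

Definition exp_add_one : fps := fun n => fps_expt 1 n + fps_one n.

(* C_n^(k). Numerator and denominator Li_k(1 - e^-t) and e^t - 1 both have
   zero constant term and are first divided by t; see poly_bernoulliP. *)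
Definition poly_bernoulli (k : int) (n : nat) : rat :=
  n`!%:R * fps_div (fps_divX (Li_one_sub_exp k)) (fps_divX exp_sub_one) n.

Definition genocchi (n : nat) : rat :=
  n`!%:R * fps_div (fun m => 2 * (m == 1%N)%:R) exp_add_one n.

Lemma size_fps_div_seq f g n : size (fps_div_seq f g n) = n.
Proof. by elim: n => //= n IHn; rewrite size_rcons IHn. Qed.

Lemma nth_fps_div_seq f g n i :
  (i < n)%N -> (fps_div_seq f g n)`_i = fps_div f g i.
Proof.
elim: n => // n IHn; rewrite ltnS leq_eqVlt => /predU1P[->//|lt_in].
by rewrite /= nth_rcons size_fps_div_seq lt_in IHn.
Qed.

Lemma fps_divE f g n : fps_div f g n =
  (f n - \sum_(i < n) g (n - i)%N * fps_div f g i) / g 0%N.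
Proof.
rewrite {1}/fps_div /= nth_rcons size_fps_div_seq ltnn eqxx.
by under eq_bigr => i _ do rewrite nth_fps_div_seq //.
Qed.

Lemma fps_divK f g : g 0%N != 0 -> fps_mul (fps_div f g) g =1 f.
Proof.
move=> g0 n; rewrite /fps_mul big_ord_recr /= subnn.
rewrite [fps_div f g n]fps_divE divfK //.
by under eq_bigr => i _ do rewrite mulrC; rewrite addrC subrK.
Qed.

Lemma egfK a : egf (fun n => n`!%:R * a n) =1 a.
Proof. by move=> n; rewrite /egf mulrC mulKf // pnatr_eq0 -lt0n fact_gt0. Qed.

Lemma poly_bernoulliP k :
  fps_mul (egf (poly_bernoulli k)) exp_sub_one =1 Li_one_sub_exp k.
Proof.
have e0 : exp_sub_one 0%N = 0 by [].
case=> [|n]; rewrite /fps_mul.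
  rewrite big_ord1 e0 mulr0 /Li_one_sub_exp /fps_comp big_ord1.
  by rewrite /Li /= mul0r.
rewrite big_ord_recr /= subnn e0 mulr0 addr0.
rewrite -[RHS](@fps_divK (fps_divX (Li_one_sub_exp k)) (fps_divX exp_sub_one)).
  by apply: eq_bigr => i _; rewrite egfK subSn // -ltnS.
by [].
Qed.

Lemma poly_bernoulli_unique k (a : nat -> rat) :
  fps_mul (egf a) exp_sub_one =1 Li_one_sub_exp k -> a =1 poly_bernoulli k.
Proof.
move=> Ha; elim/ltn_ind=> n IHn.
have e0 : exp_sub_one 0%N = 0 by [].
have e1 : exp_sub_one 1%N = 1 by [].
have := etrans (Ha n.+1) (esym (poly_bernoulliP k n.+1)).
rewrite /fps_mul 2!big_ord_recr [RHS]big_ord_recr [in RHS]big_ord_recr /=.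
rewrite subnn subSnn e0 e1 !mulr0 !addr0 !mulr1.
under eq_bigr => i _ do rewrite /egf IHn //.
move/addrI => /(congr1 ( *%R^~ n`!%:R)); rewrite /egf !divfK //.
all: by rewrite pnatr_eq0 -lt0n fact_gt0.
Qed.

Lemma genocchiP :
  fps_mul (egf genocchi) exp_add_one =1 (fun n => 2 * (n == 1%N)%:R).
Proof.
move=> n; rewrite -[RHS](@fps_divK (fun m => 2 * (m == 1%N)%:R) exp_add_one) //.
by apply: eq_bigr => i _; rewrite egfK.
Qed.

(* Main.v *)
Require Import Defs.
From mathcomp Require Import all_boot all_order all_algebra.
From mathcomp Require Import ring zify.
Import Order.TTheory GRing.Theory Num.Theory.
Local Open Scope ring_scope.

(* Write Delta for the forward difference operator on functions of x, so that
   a_j(n) := (Delta^j x^n)(0) = j! S(n, j). Expanding Li_(-k)(1 - e^-t) in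
   powers of 1 - e^-t gives a recurrence in k for C_n^(-k-1), whose solution is
     C_n^(-k-1) = \sum_j a_(j+1)(n+1) a_(j+1)(k+1) / (j+1).
   Hence the alternating sum is -\sum_j F_(j+1)(n+2) / (j+1), where F_j is the
   convolution of a_j with (-1)^l a_j(l). Up to a factor depending on j, F_j has
   exponential generating function w^j with w = e^t - 2 + e^-t. The series
   \sum_j F_j / j^2 telescopes to -t^2 / 2, and
   (e^t - 1) (w^j)' = j (e^t + 1) w^j then turns it into
     (e^t + 1) \sum_j F_j / j = - t (e^t - 1),
   which determines \sum_j F_j / j = 2 t / (e^t + 1) - t. *)

(** * Forward differences of powers *)

Definition fdiff (f : rat -> rat) : rat -> rat := fun x => f (x + 1) - f x.

Definition fdiffn (m : nat) (f : rat -> rat) : rat -> rat := iter m fdiff f.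

Arguments fdiffn : simpl never.

Notation pow n := (fun x : rat => x ^+ n).

Lemma fdiffnS m f x : fdiffn m.+1 f x = fdiffn m f (x + 1) - fdiffn m f x.
Proof. by []. Qed.

Lemma fdiffnSr m f x : fdiffn m.+1 f x = fdiffn m (fdiff f) x.
Proof. by rewrite /fdiffn iterSr. Qed.

Lemma eq_fdiffn m f g : f =1 g -> fdiffn m f =1 fdiffn m g.
Proof. by move=> fg; elim: m => // m IHm x; rewrite !fdiffnS !IHm. Qed.

Lemma fdiffn_sum m n (c : 'I_n -> rat) (f : 'I_n -> rat -> rat) x :
  fdiffn m (fun y => \sum_(i < n) c i * f i y) x =
  \sum_(i < n) c i * fdiffn m (f i) x.
Proof.
elim: m x => // m IHm x; rewrite fdiffnS !IHm -sumrB.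
by apply: eq_bigr => i _; rewrite fdiffnS mulrBr.
Qed.

Lemma fdiffn_shift m f c x :
  fdiffn m (fun y => f (y + c)) x = fdiffn m f (x + c).
Proof. by elim: m x => // m IHm x; rewrite !fdiffnS !IHm addrAC. Qed.

(** Leibniz rule: the second difference of y vanishes, leaving two terms. At [m = 0] the junk value
    of [m.-1] is killed by the factor [m%:R]. *)
Lemma fdiffn_mulX m f x :
  fdiffn m (fun y => y * f y) x =
  x * fdiffn m f x + m%:R * fdiffn m.-1 f (x + 1).
Proof.
elim: m x => [|m IHm] x; first by rewrite /= mul0r addr0.
rewrite fdiffnS !IHm [m.+1.-1]/= fdiffnS -natr1.
case: m {IHm} => [|m]; first by rewrite /=; ring.
by rewrite [m.+1.-1]/= !fdiffnS; ring.
Qed.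

Lemma fdiffn_powS m n x :
  fdiffn m (pow n.+1) x =
  x * fdiffn m (pow n) x + m%:R * fdiffn m.-1 (pow n) (x + 1).
Proof. by rewrite -fdiffn_mulX; apply: eq_fdiffn => y; rewrite exprS. Qed.

Lemma fdiffn_pow_eq0 m n x : (n < m)%N -> fdiffn m (pow n) x = 0.
Proof.
elim: n m x => [|n IHn] [|m] x // lt_nm.
  by elim: m x {lt_nm} => [|m IHm] x; rewrite fdiffnS ?IHm subrr.
by rewrite fdiffn_powS !IHn ?mulr0 ?addr0 //; lia.
Qed.

Lemma fdiff_pow n x : fdiff (pow n) x = \sum_(i < n) 'C(n, i)%:R * x ^+ i.
Proof.
rewrite /fdiff exprD1n big_ord_recr /= binn mulr1n addrK.
by apply: eq_bigr => i _; rewrite mulr_natl.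
Qed.

(** Coefficientwise, multiplying an exponential generating function by e^t - 1 raises the order of
    the difference by one. *)
Lemma sum_bin_fdiffn m n x :
  \sum_(i < n) 'C(n, i)%:R * fdiffn m (pow i) x = fdiffn m.+1 (pow n) x.
Proof.
rewrite fdiffnSr (eq_fdiffn _ _ (fun y => \sum_(i < n) 'C(n, i)%:R * y ^+ i)).
  by rewrite (fdiffn_sum _ _ _ (fun i => pow i)).
exact: fdiff_pow.
Qed.

Lemma sum_bin_fdiffnS m n x :
  \sum_(i < n) 'C(n, i)%:R * fdiffn m (pow i.+1) x =
  x * fdiffn m.+1 (pow n) x + m%:R * fdiffn m.-1.+1 (pow n) (x + 1).
Proof.
under eq_bigr => i _ do rewrite fdiffn_powS mulrDr !(mulrCA 'C(n, i)%:R).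
by rewrite big_split -!mulr_sumr !sum_bin_fdiffn.
Qed.

(** * Powers of 1 - e^-t and poly-Bernoulli numbers of negative index *)

Lemma factr_neq0 n : n`!%:R != 0 :> rat.
Proof. by rewrite pnatr_eq0 -lt0n fact_gt0. Qed.

Lemma mul_egf (a b : nat -> rat) n :
  n`!%:R * fps_mul (egf a) (egf b) n =
  \sum_(i < n.+1) 'C(n, i)%:R * a i * b (n - i)%N.
Proof.
rewrite mulr_sumr; apply: eq_bigr => i _; rewrite /egf.
have le_in : (i <= n)%N by rewrite -ltnS.
rewrite -(bin_fact le_in) !natrM.
by field; rewrite !factr_neq0.
Qed.

(** The differences of order m at x have exponential generating function e^(x t) (e^t - 1)^m, and (1
    - e^-t)^m is the case x = -m. *)
Lemma fps_exp_one_sub_exp m n :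
  fps_exp (fun n => fps_one n - fps_expt (-1) n) m n =
  fdiffn m (pow n) (- m%:R) / n`!%:R.
Proof.
elim: m n => [|m IHm] n.
  by rewrite oppr0 /fdiffn /= expr0n; case: n => [|n]; rewrite ?mul0r // divr1.
rewrite [LHS]/=.
have -> : fps_mul (fun n => fps_one n - fps_expt (-1) n)
    (fps_exp (fun n => fps_one n - fps_expt (-1) n) m) n =
  fdiffn m (pow n) (- m%:R) / n`!%:R
  - fps_mul (fps_expt (-1)) (egf (fun i => fdiffn m (pow i) (- m%:R))) n.
  rewrite /fps_mul; under eq_bigr => i _ do rewrite IHm mulrBl.
  rewrite sumrB; congr (_ - _); rewrite big_ord_recl big1 => [|i _].
    by rewrite subn0 /fps_one eqxx mul1r addr0.
  by rewrite /fps_one mul0r.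
apply: (mulfI (factr_neq0 n)); rewrite mulrBr mul_egf !(mulrC n`!%:R).
rewrite !divfK ?factr_neq0 // fdiffnS -natr1 opprD subrK; congr (_ - _).
(* Multiplication by e^-t moves the base point by -1, so it amounts to expanding (y - 1)^n. *)
rewrite -fdiffn_shift.
rewrite (reindex_inj rev_ord_inj) /=.
rewrite (eq_fdiffn _ _ (fun y => \sum_(i < n.+1)
  ('C(n, i)%:R * (-1) ^+ (n - i)) * y ^+ i)) => [|y].
  rewrite (fdiffn_sum _ _ _ (fun i => pow i)); apply: eq_bigr => i _.
  have le_in : (i <= n)%N by rewrite -ltnS.
  by rewrite subSS subKn // bin_sub.
rewrite addrC exprDn; apply: eq_bigr => i _.
by rewrite -mulr_natl mulrA.
Qed.

(** For z = 1 - e^-t, (e^t - 1) d/dt = z d/dz, which multiplies z^m by m. *)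
Lemma sum_bin_exp_fdiffn k N n :
  \sum_(i < n) 'C(n, i)%:R *
    (\sum_(m < N) m%:R ^+ k * fdiffn m (pow i.+1) (- m%:R)) =
  \sum_(m < N) m%:R ^+ k.+1 * fdiffn m (pow n) (- m%:R).
Proof.
under eq_bigr => i _ do rewrite mulr_sumr.
rewrite exchange_big /=; apply: eq_bigr => -[[|m] lt_m] _ /=.
  rewrite exprS !mul0r big1 // => i _.
  by rewrite oppr0 /fdiffn /= exprS mul0r !mulr0.
under eq_bigr => i _ do rewrite mulrCA.
rewrite -mulr_sumr sum_bin_fdiffnS !fdiffnS exprSr -!natr1.
by ring.
Qed.

Lemma widen_sum_fdiffn k N n : (n < N)%N ->
  \sum_(m < N) m%:R ^+ k * fdiffn m (pow n) (- m%:R) =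
  \sum_(m < n.+1) m%:R ^+ k * fdiffn m (pow n) (- m%:R).
Proof.
move=> /subnKC <-; rewrite big_split_ord /= [X in _ + X]big1 ?addr0 // => i _.
by rewrite fdiffn_pow_eq0 ?mulr0 //=; lia.
Qed.

(* The sum is Li_(-k)(1 - e^-t) expanded in the powers of 1 - e^-t. *)
Lemma poly_bernoulli_fdiffn k n :
  poly_bernoulli (- k%:Z - 1) n =
  \sum_(m < n.+2) m%:R ^+ k * fdiffn m (pow n.+1) (- m%:R).
Proof.
pose P n := \sum_(m < n.+2) m%:R ^+ k * fdiffn m (pow n.+1) (- m%:R).
symmetry; apply: (@poly_bernoulli_unique _ P) => {}n.
apply: (mulfI (factr_neq0 n)).
have -> : fps_mul (egf P) exp_sub_one n =
    fps_mul (egf P) (egf (fun n => (n != 0%N)%:R)) n.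
  apply: eq_bigr => i _; congr (_ * _); rewrite /exp_sub_one /fps_one.
  rewrite /fps_expt /egf expr1n; case: (n - i)%N => [|j] /=.
    by rewrite divr1 subrr mul0r.
  by rewrite subr0.
rewrite mul_egf big_ord_recr /= subnn mulr0 addr0.
transitivity (\sum_(m < n.+1) m%:R ^+ k.+1 * fdiffn m (pow n) (- m%:R)).
  rewrite -sum_bin_exp_fdiffn; apply: eq_bigr => i _.
  by rewrite -lt0n subn_gt0 ltn_ord mulr1 [in RHS]widen_sum_fdiffn // ltnS.
rewrite /Li_one_sub_exp /fps_comp mulr_sumr; apply: eq_bigr => i _.
rewrite fps_exp_one_sub_exp mulrCA [n`!%:R * _]mulrC divfK ?factr_neq0 //.
rewrite /Li; have -> : - (- k%:Z - 1) = k.+1 by lia.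
by case: (i : nat) => [|m] //=; rewrite expr0n.
Qed.

(** Telescopes, since -m = 1 - (m + 1). *)
Lemma sum_fdiffn_opp M f :
  \sum_(m < M) fdiffn m f (- m%:R) = f 1 - fdiffn M f (1 - M%:R).
Proof.
elim: M => [|M IHM]; first by rewrite big_ord0 subr0 subrr.
rewrite big_ord_recr /= IHM fdiffnS -natr1.
have -> : 1 - (M%:R + 1) = - M%:R :> rat by ring.
by rewrite [- M%:R + 1]addrC; ring.
Qed.

Lemma poly_bernoulli_N1 n : poly_bernoulli (- 0%:Z - 1) n = 1.
Proof.
rewrite poly_bernoulli_fdiffn; under eq_bigr => i _ do rewrite mul1r.
by rewrite sum_fdiffn_opp expr1n fdiffn_pow_eq0 ?subr0.
Qed.

Lemma poly_bernoulli_rec k n :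
  poly_bernoulli (- k.+1%:Z - 1) n =
  \sum_(i < n.+1) 'C(n.+1, i)%:R * poly_bernoulli (- k%:Z - 1) i.
Proof.
rewrite poly_bernoulli_fdiffn -sum_bin_exp_fdiffn; apply: eq_bigr => i _.
by rewrite poly_bernoulli_fdiffn widen_sum_fdiffn // ltnS.
Qed.

(** * Symmetric closed formula for the poly-Bernoulli numbers *)

Lemma telescope_ord (f : nat -> rat) N :
  \sum_(i < N) (f i.+1 - f i) = f N - f 0%N.
Proof. by rewrite -(telescope_sumr f (leq0n N)) big_mkord. Qed.

(* [j! S(n, j)] with [S] the Stirling numbers of the second kind. *)
Definition surj (j n : nat) : rat := fdiffn j (pow n) 0.

Lemma surj_rec j n : surj j.+1 n.+1 = j.+1%:R * (surj j.+1 n + surj j n).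
Proof. by rewrite /surj fdiffn_powS mul0r add0r fdiffnS subrK. Qed.

Lemma surj_eq0 j n : (n < j)%N -> surj j n = 0.
Proof. exact: fdiffn_pow_eq0. Qed.

Lemma surj0 n : surj 0 n = 0 ^+ n.
Proof. by []. Qed.

(** Terms with [j > k] vanish, so one bound [N] can serve all [k], both in the induction and in the
    later exchange of sums. *)
Lemma poly_bernoulli_surj k n N : (k < N)%N ->
  poly_bernoulli (- k%:Z - 1) n =
  \sum_(j < N) surj j.+1 n.+1 * surj j.+1 k.+1 / j.+1%:R.
Proof.
elim: k n => [|k IHk] n lt_kN.
  case: N lt_kN => // N _; rewrite poly_bernoulli_N1 big_ord_recl.
  rewrite big1 => [|i _]; last by rewrite (surj_eq0 _ 1) ?mulr0 ?mul0r.
  rewrite /surj /fdiffn /= /fdiff add0r !expr1n !expr0n /=.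
  by rewrite addr0 !subr0.
rewrite poly_bernoulli_rec.
under eq_bigr => i _ do rewrite (IHk _ (ltnW lt_kN)) mulr_sumr.
rewrite exchange_big /=; apply/eqP; rewrite -subr_eq0 -sumrB; apply/eqP.
(* The recurrence in [k] and the claimed formula differ by a telescoping sum over [j]. *)
transitivity (\sum_(j < N) (surj j.+2 n.+1 * surj j.+1 k.+1
                            - surj j.+1 n.+1 * surj j k.+1)).
  apply: eq_bigr => j _.
  have nz_j : j.+1%:R != 0 :> rat by rewrite pnatr_eq0.
  under eq_bigr => i _ do rewrite -mulrA mulrA.
  rewrite -mulr_suml sum_bin_fdiffnS mul0r add0r.
  have -> : fdiffn j.+1 (pow n.+1) (0 + 1) = surj j.+2 n.+1 + surj j.+1 n.+1.
    by rewrite /surj [fdiffn j.+2 _ _]fdiffnS subrK.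
  by rewrite (surj_rec j k.+1); move: j.+1%:R nz_j => c nz_c; field.
rewrite [LHS](telescope_ord (fun j => surj j.+1 n.+1 * surj j k.+1)).
by rewrite (surj_eq0 N) // surj0 expr0n !mulr0 subrr.
Qed.

(** * Alternating convolutions of [surj] as central differences *)

Definition sconv (u v : nat -> rat) (n : nat) : rat :=
  \sum_(l < n.+1) (-1) ^+ l * (u (n - l)%N * v l).

Lemma sconvSl u v n : u 0%N = 0 ->
  sconv u v n.+1 = sconv (fun i => u i.+1) v n.
Proof.
move=> u0; rewrite /sconv big_ord_recr /= subnn u0 mul0r mulr0 addr0.
by apply: eq_bigr => i _; rewrite subSn // -ltnS.
Qed.

Lemma sconvSr u v n : v 0%N = 0 ->
  sconv u v n.+1 = - sconv u (fun i => v i.+1) n.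
Proof.
move=> v0; rewrite /sconv big_ord_recl v0 !mulr0 add0r -sumrN.
by apply: eq_bigr => i _; rewrite /= exprS mulN1r mulNr.
Qed.

Lemma sconvDl c u v w n :
  sconv (fun i => c * (u i + v i)) w n = c * (sconv u w n + sconv v w n).
Proof.
rewrite /sconv -big_split mulr_sumr; apply: eq_bigr => i _ /=.
by ring.
Qed.

Lemma sconvDr c u v w n :
  sconv w (fun i => c * (u i + v i)) n = c * (sconv w u n + sconv w v n).
Proof.
rewrite /sconv -big_split mulr_sumr; apply: eq_bigr => i _ /=.
by ring.
Qed.

Lemma eq_sconv u u' v v' n : u =1 u' -> v =1 v' -> sconv u v n = sconv u' v' n.
Proof. by move=> uu' vv'; apply: eq_bigr => i _; rewrite uu' vv'. Qed.

Lemma sconv_surj_rec j n :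
  sconv (surj j.+1) (surj j.+1) n.+2 =
  j.+1%:R ^+ 2 * (sconv (surj j.+1) (surj j.+1) n - sconv (surj j) (surj j) n).
Proof.
have s0 : surj j.+1 0 = 0 by rewrite surj_eq0.
have sl w i : sconv (surj j.+1) w i.+1 =
    j.+1%:R * (sconv (surj j.+1) w i + sconv (surj j) w i).
  rewrite sconvSl // -sconvDl; apply: eq_sconv => // l; exact: surj_rec.
have sr w i : sconv w (surj j.+1) i.+1 =
    - (j.+1%:R * (sconv w (surj j.+1) i + sconv w (surj j) i)).
  rewrite sconvSr // -sconvDr; congr (- _); apply: eq_sconv => // l.
  exact: surj_rec.
rewrite sl sr [sconv (surj j) _ n.+1]sr.
(* Reducing the left or the right factor gives two values of the convolution at [n.+1]; equating
   them eliminates the mixed terms. *)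
have := sl (surj j.+1) n; rewrite sr => ->.
by ring.
Qed.

(* [(-1)^j j!^2] times a central factorial number: [fdiffn j.*2 f (- j%:R)] is
   the central difference of order [2 j] of [f] at [0]. *)
Definition cfact (j n : nat) : rat :=
  (-1) ^+ j * j`!%:R ^+ 2 / (j.*2)`!%:R * fdiffn j.*2 (pow n) (- j%:R).

Lemma cfact_eq0 j n : (n < j.*2)%N -> cfact j n = 0.
Proof. by move=> lt_nj; rewrite /cfact fdiffn_pow_eq0 ?mulr0. Qed.

Lemma cfact0 n : cfact 0 n = 0 ^+ n.
Proof. by rewrite /cfact oppr0 expr1n divr1 !mul1r. Qed.

(** For w = e^t - 2 + e^-t this is (w^j)'' = j^2 w^j + 2j (2j - 1) w^(j-1), rescaled and with j + 1
    for j. *)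
Lemma cfact_rec j n :
  cfact j.+1 n.+2 = j.+1%:R ^+ 2 * (cfact j.+1 n - cfact j n).
Proof.
rewrite /cfact doubleS fdiffn_powS !(fdiffn_powS _ n) [j.*2.+2.-1]/=.
rewrite [j.*2.+1.-1]/= !fdiffnS !factS !natrM -!natr1 -mul2n natrM.
have -> : - (j%:R + 1) + 1 = - j%:R :> rat by ring.
have nz1 : 2 * j%:R + 1 + 1 != 0 :> rat by rewrite -natrM !natr1 pnatr_eq0.
have nz2 : 2 * j%:R + 1 != 0 :> rat by rewrite -natrM natr1 pnatr_eq0.
rewrite exprS mulN1r; move: (factr_neq0 (2 * j)) nz1 nz2.
move: (2 * j)`!%:R j`!%:R ((-1) ^+ j) => u v w nz_u.
move: (fdiffn (2 * j) (pow n)) (j%:R) => f c nz1 nz2.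
by field; rewrite nz_u nz1 nz2.
Qed.

(** Both sides satisfy the same recurrence, which steps [n] by two: hence the base cases [n = 0],
    [n = 1] and [j = 0]. *)
Lemma sconv_surj j n : sconv (surj j) (surj j) n = cfact j n.
Proof.
elim/ltn_ind: n j => -[|[|n]] IHn [|j].
- by rewrite /sconv big_ord1 cfact0 surj0 !mul1r.
- by rewrite /sconv big_ord1 surj_eq0 // cfact_eq0 // mul0r mulr0.
- by rewrite cfact0 /sconv big1 // => -[[|[|i]]] //= _ _.
- rewrite cfact_eq0 // /sconv big1 // => -[[|[|i]]] //= _ _.
    by rewrite (surj_eq0 _ 0) // !mulr0.
  by rewrite (surj_eq0 _ 0) // mul0r mulr0.
- rewrite cfact0 /sconv big1 ?expr0n // => i _.
  by rewrite !surj0 -exprD subnK ?expr0n ?mulr0 // -ltnS.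
- by rewrite sconv_surj_rec cfact_rec !IHn.
Qed.

(* Coefficientwise form of the differential equation
   [(e^t - 1) f' = j (e^t + 1) f] of [f = (e^(t/2) - e^(-t/2))^(2 j)]. *)
Lemma sum_bin_cfact j n :
  \sum_(i < n) 'C(n, i)%:R * cfact j i.+1 =
  j%:R * (\sum_(i < n.+1) 'C(n, i)%:R * cfact j i + cfact j n).
Proof.
rewrite big_ord_recr /= binn mul1r /cfact.
under eq_bigr => i _ do rewrite mulrCA.
under [in RHS]eq_bigr => i _ do rewrite mulrCA.
rewrite -!mulr_sumr sum_bin_fdiffnS sum_bin_fdiffn.
case: j => [|j]; first by rewrite oppr0 !mul0r addr0 mulr0.
have -> : j.+1.*2.-1.+1 = j.+1.*2 by [].
by rewrite !fdiffnS -[X in X%:R * _]mul2n natrM; ring.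
Qed.

(* Up to the factor [-2], the series [t^2] expanded in the even powers of
   [e^(t/2) - e^(-t/2)]; the recurrence of [cfact] makes it telescope. *)
Lemma sum_cfact_sqr N n : (n < N.*2)%N ->
  \sum_(j < N) cfact j.+1 n.+1 / j.+1%:R ^+ 2 = - (n == 1%N)%:R.
Proof.
case: n => [|n] lt_nN.
  by rewrite big1 ?oppr0 // => j _; rewrite cfact_eq0 ?mul0r.
under eq_bigr => j _ do
  rewrite cfact_rec mulrAC divff ?expf_neq0 ?pnatr_eq0 // mul1r.
rewrite [LHS](telescope_ord (fun j => cfact j n)) cfact_eq0 1?ltnW // cfact0.
by rewrite sub0r expr0n.
Qed.

(** * Genocchi numbers *)

Lemma genocchi_rec n :
  \sum_(i < n.+1) 'C(n, i)%:R * genocchi i + genocchi n = 2 * (n == 1%N)%:R.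
Proof.
have -> : 2 * (n == 1%N)%:R = n`!%:R * (2 * (n == 1%N)%:R) :> rat.
  by case: eqP => [->|_]; rewrite ?mul1r // !mulr0.
rewrite -genocchiP.
have -> : fps_mul (egf genocchi) exp_add_one n =
    fps_mul (egf genocchi) (egf (fun n => 1 + (n == 0%N)%:R)) n.
  apply: eq_bigr => i _; congr (_ * _); rewrite /exp_add_one /fps_one.
  rewrite /fps_expt /egf expr1n mulrDl; congr (_ + _).
  by case: (n - i)%N => [|j]; rewrite ?divr1 ?mul0r.
rewrite mul_egf !big_ord_recr /= subnn binn eqxx.
rewrite -[LHS]addrA; congr (_ + _); last by rewrite mul1r mulrDr mulr1.
by apply: eq_bigr => i _; rewrite subn_eq0 leqNgt ltn_ord addr0 mulr1.
Qed.

(** Each equation determines [a n], with coefficient 2, from earlier values; the bound [N] allows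
    for truncated sums over [j]. *)
Lemma genocchi_unique N (a : nat -> rat) :
  (forall n, (n <= N)%N ->
     \sum_(i < n.+1) 'C(n, i)%:R * a i + a n = 2 * (n == 1%N)%:R) ->
  forall n, (n <= N)%N -> a n = genocchi n.
Proof.
move=> Ha; elim/ltn_ind=> n IHn le_nN.
have := Ha n le_nN; rewrite -genocchi_rec !big_ord_recr /= binn !mul1r -!addrA.
under eq_bigr => i _ do rewrite IHn // ?(leq_trans (ltnW (ltn_ord i))) //.
by move/addrI => eq2; apply: (@mulfI _ 2) => //; rewrite !mulr_natl !mulr2n.
Qed.

Lemma sum_cfact N n : (n <= N)%N ->
  \sum_(j < N) cfact j.+1 n / j.+1%:R = genocchi n - (n == 1%N)%:R.
Proof.
move=> le_nN; pose a n := \sum_(j < N) cfact j.+1 n / j.+1%:R + (n == 1%N)%:R.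
rewrite -(genocchi_unique N a) ?addrK // => {le_nN}n le_nN.
have sumc : \sum_(i < n.+1) 'C(n, i)%:R * (\sum_(j < N) cfact j.+1 i / j.+1%:R)
    + \sum_(j < N) cfact j.+1 n / j.+1%:R
  = - \sum_(i < n) 'C(n, i)%:R * (i == 1%N :> nat)%:R.
  (* Dividing the differential equation by j^2 turns (e^t + 1) times the series with weights 1/j
     into (e^t - 1) times the derivative of the one with weights 1/j^2. *)
  transitivity (\sum_(i < n) 'C(n, i)%:R *
    (\sum_(j < N) cfact j.+1 i.+1 / j.+1%:R ^+ 2)); last first.
    rewrite -sumrN; apply: eq_bigr => i _; rewrite sum_cfact_sqr ?mulrN //.
    by have := ltn_ord i; lia.
  under eq_bigr => i _ do rewrite mulr_sumr.
  under [in RHS]eq_bigr => i _ do rewrite mulr_sumr.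
  rewrite exchange_big [in RHS]exchange_big /= -big_split.
  apply: eq_bigr => j _.
  have nz_j : j.+1%:R != 0 :> rat by rewrite pnatr_eq0.
  under eq_bigr => i _ do rewrite mulrA.
  under [in RHS]eq_bigr => i _ do rewrite mulrA.
  rewrite /= -!mulr_suml sum_bin_cfact; move: j.+1%:R nz_j => c nz_c.
  by field.
rewrite {}/a; under eq_bigr => i _ do rewrite mulrDr.
rewrite big_split /= addrACA sumc big_ord_recr /= binn mul1r.
by ring.
Qed.

Theorem theorem4p2 (n : nat) :
  \sum_(0 <= l < n.+1) (-1) ^+ l * poly_bernoulli (- l%:Z - 1) (n - l)
    = - genocchi n.+2.
Proof.
rewrite -[genocchi _]subr0 -(sum_cfact n.+2) // big_mkord.
under eq_bigr => l _ do
  rewrite (poly_bernoulli_surj _ _ n.+2) ?(ltn_trans (ltn_ord l)) // mulr_sumr.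
rewrite exchange_big /= -sumrN; apply: eq_bigr => j _.
(* Since [surj j.+1 0 = 0], both arguments can be shifted by one; the shift on the right produces
   the sign. *)
rewrite -sconv_surj sconvSl ?surj_eq0 // sconvSr ?surj_eq0 // mulNr opprK.
by rewrite mulr_suml; apply: eq_bigr => l _; rewrite mulrA.
Qed.
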